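(* Let $m\ge1$, let $p_1,\dots,p_m\ge 0$ with $p_1+\cdots+p_m=1$, and let $S$ be a finite nonempty word on $[m]=\{1,\dots,m\}$ all of whose letters have positive probability. Roll a die showing face $i$ with probability $p_i$ independently until $S$ first appears as a block of consecutive outcomes, and let $Y$ be the number of rolls. Then for every integer $n\ge 1$, \[ E(Y^n) = \sum_{\pi\in\Pi_n} |\pi|! \prod_{B\in \pi} \sum_{R\in\operatorname{overlap}(S)} \frac{(1-|R|)^{|B|} - (-|R|)^{|B|}}{P(R)}. \]
   Context: For a word $w=w_1\cdots w_\ell$, $|w|=\ell$ and $P(w)=p_{w_1}\cdots p_{w_\ell}$. An overlap of $S$ is a nonempty word that is both a prefix and a suffix of $S$ (including $S$ itself); $\operatorname{overlap}(S)$ is the set of overlaps. $\Pi_n$ is the set of set partitions of $\{1,\dots,n\}$; $|\pi|$ is the number of blocks of $\pi$ and $|B|$ the size of block $B$. Convention $0^0=1$. *)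

(* Defs.v *)
From HB Require Import structures.
From mathcomp Require Import all_boot all_order all_algebra.

Set Implicit Arguments. Unset Strict Implicit. Unset Printing Implicit Defensive.
Import Order.TTheory GRing.Theory Num.Theory.
Local Open Scope ring_scope.

Definition Pw (R : numDomainType) (m : nat) (p : 'I_m -> R) (w : seq 'I_m) : R :=
  \prod_(a <- w) p a.

(* overlap(S): the nonempty words that are both a prefix and a suffix of S
   (including S itself), listed by length (distinct lengths give distinct
   words, so this list has no duplicates). *)
Definition overlaps (m : nat) (S : seq 'I_m) : seq (seq 'I_m) :=
  [seq take k S | k <- iota 1 (size S) & prefix (take k S) S && suffix (take k S) S].

Definition first_occ (m : nat) (S w : seq 'I_m) : bool :=
  suffix S w && ~~ infix S (take (size w).-1 w).

Definition probY (R : numDomainType) (m : nat) (p : 'I_m -> R) (S : seq 'I_m) (k : nat) : R :=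
  \sum_(w : k.-tuple 'I_m | first_occ S w) Pw p w.

Definition set_partitions (n : nat) : {set {set {set 'I_n}}} :=
  [set P : {set {set 'I_n}} | partition P [set: 'I_n]].

(* Main.v *)
(* Let q_k = P(Y = k) and Q_k = P(Y > k).  Appending S to a word of length k
   that avoids S forces a first occurrence of S at some time k + j, and the first
   j letters of S then form an overlap; hence Q_k = sum_R q_(k+|R|) / P(R).
   Since q_(k+1) = Q_k - Q_(k+1), this relation bounds all the moments of Y by
   induction, and summation by parts of sum_k ((k+1)^n - k^n) Q_k = E(Y^n) gives,
   with f_j = sum_R ((1-|R|)^j - (-|R|)^j) / P(R),
     E(Y^n) = sum_j C(n, j) f_j E(Y^(n-j))   for n >= 1.
   The sum over set partitions obeys the same recursion: |pi|! counts the
   orderings of the blocks of pi, and j is the size of the first block. *)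
Require Import Defs.
From HB Require Import structures.
From mathcomp Require Import all_boot all_order all_algebra.
Set Implicit Arguments. Unset Strict Implicit. Unset Printing Implicit Defensive.
Import Order.TTheory GRing.Theory Num.Theory.
Local Open Scope ring_scope.

(** * Set partitions with ordered blocks *)

Section OrderedPartitions.
Variables (R : comNzRingType) (T : finType) (f : nat -> R).

Definition partition_sum (A : {set T}) : R :=
  \sum_(P : {set {set T}} | partition P A)
    (factorial #|P|)%:R * \prod_(B in P) f #|B|.

Lemma partition_sum0 : partition_sum set0 = 1.
Proof.
rewrite /partition_sum (big_pred1 set0) => [|P]; last exact: partition_set0.
by rewrite cards0 big_set0 mulr1.
Qed.

(* The factor |P|! orders the blocks; the recursion removes the first one. *)
Lemma partition_sum_rec (A : {set T}) : A != set0 ->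
  partition_sum A =
  \sum_(B : {set T} | (B \subset A) && (B != set0))
     f #|B| * partition_sum (A :\: B).
Proof.
move=> A0.
transitivity (\sum_(P : {set {set T}} | partition P A) \sum_(B in P)
   f #|B| * ((factorial #|P :\ B|)%:R * \prod_(C in P :\ B) f #|C|)).
  apply: eq_bigr => P partP.
  have P0 : (0 < #|P|)%N.
    rewrite card_gt0; apply: contraNneq A0 => P0.
    by rewrite -(cover_partition partP) P0 /cover big_set0.
  transitivity (\sum_(B in P)
      ((factorial #|P|.-1)%:R * \prod_(C in P) f #|C|)).
    rewrite sumr_const -[RHS]mulr_natl mulrA -natrM.
    by case: #|P| P0 => // k _; rewrite factS.
  apply: eq_bigr => B BP.
  by rewrite (big_setD1 B BP) /= (cardsD1 B P) BP add1n /= mulrCA.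
rewrite (exchange_big_dep (fun B : {set T} => (B \subset A) && (B != set0))) /=; last first.
  by move=> P B partP BP; rewrite (partitionS partP) ?(partition_neq0 partP).
apply: eq_bigr => B /andP[sBA B0]; rewrite -mulr_sumr; congr (_ * _).
rewrite /partition_sum (reindex_onto (fun P : {set {set T}} => B |: P) (fun P => P :\ B)); last first.
  by move=> P /andP[_ BP]; rewrite setD1K.
apply: eq_big => [P|P /andP[_ /eqP->] //].
rewrite setU11 andbT; apply/andP/idP => [[partP /eqP <-]|partP].
  by apply: partitionD1 => //; rewrite setU11.
have BP : B \notin P.
  apply: contra B0 => /(partitionS partP) /subsetP sB.
  apply/eqP/setP => x; rewrite in_set0; apply/negP => xB.
  by have := sB x xB; rewrite !inE xB.
split; last by rewrite setU1K.
rewrite -[A](setID _ B) (setIidPr sBA); apply: partitionU1 => //.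
by rewrite disjoint_sym disjoints_subset; apply/subsetP => x; rewrite !inE => /andP[].
Qed.

Lemma sum_subsets_card (A : {set T}) (g : nat -> R) :
  \sum_(B : {set T} | B \subset A) g #|B| =
  \sum_(j < #|A|.+1) 'C(#|A|, j)%:R * g j.
Proof.
rewrite (partition_big (fun B : {set T} => inord #|B| : 'I_#|A|.+1) xpredT) //=.
apply: eq_bigr => j _.
rewrite -cards_draws mulr_natl -sumr_const; apply: eq_big => [B|B].
  rewrite inE; apply: andb_id2l => sBA.
  by rewrite -val_eqE /= inordK // ltnS subset_leq_card.
case/andP=> sBA /eqP <-; rewrite inordK // ltnS; exact: subset_leq_card.
Qed.

(** Strong induction on the size of [A], matching the two recursions. The binomial sum has a term
    [j = 0], for the empty set, which is never a block; [f 0 = 0] removes it. *)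
Lemma partition_sumE (M : nat -> R) :
  M 0%N = 1 -> f 0%N = 0 ->
  (forall n, (0 < n)%N ->
     M n = \sum_(j < n.+1) 'C(n, j)%:R * (f j * M (n - j)%N)) ->
  forall A : {set T}, partition_sum A = M #|A|.
Proof.
move=> M0 f0 Mrec A; have [k] := ubnP #|A|; elim: k A => // k IH A.
rewrite ltnS => leAk; have [->|A0] := eqVneq A set0.
  by rewrite partition_sum0 cards0 M0.
rewrite partition_sum_rec // Mrec ?card_gt0 //.
rewrite -(sum_subsets_card A (fun j => f j * M (#|A| - j)%N)).
rewrite [RHS](bigID (fun B : {set T} => B != set0)) /=.
rewrite [X in _ = _ + X]big1 ?addr0; last first.
  by move=> B /andP[_ /negPn/eqP->]; rewrite cards0 f0 mul0r.
apply: eq_bigr => B /andP[sBA B0]; rewrite IH.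
  by rewrite cardsD (setIidPr sBA).
apply: leq_trans leAk; apply: proper_card; rewrite properEneq subsetDl andbT.
apply: contraNneq B0 => eqA; apply/eqP/setP => x; rewrite in_set0; apply/negP => xB.
by have := subsetP sBA x xB; rewrite -eqA inE xB.
Qed.

End OrderedPartitions.

(** * Averages over random words of a fixed length *)

Section Words.
Variables (R : numFieldType) (m : nat) (p : 'I_m -> R).

(** The expectation of [F] over [k] independent rolls when [p] sums to 1. [F] takes plain sequences,
    so concatenation needs no length casts. *)
Definition word_sum (k : nat) (F : seq 'I_m -> R) : R :=
  \sum_(w : k.-tuple 'I_m) Pw p w * F w.

Lemma Pw_cat u v : Pw p (u ++ v) = Pw p u * Pw p v.
Proof. by rewrite /Pw big_cat. Qed.

Lemma eq_word_sum k (F G : seq 'I_m -> R) :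
  (forall w, size w = k -> F w = G w) -> word_sum k F = word_sum k G.
Proof. by move=> FG; apply: eq_bigr => w _; rewrite FG // size_tuple. Qed.

Lemma word_sum0 F : word_sum 0 F = F [::].
Proof.
rewrite /word_sum (big_pred1 [tuple]) => [|t]; last by apply/esym/eqP; exact: tuple0.
by rewrite /Pw big_nil mul1r.
Qed.

(** Independence of the first [k] rolls from the next [j]. *)
Lemma word_sum_cat k j F :
  word_sum (k + j) F = word_sum k (fun u => word_sum j (fun v => F (u ++ v))).
Proof.
rewrite /word_sum; under [RHS]eq_bigr => u _ do rewrite mulr_sumr.
rewrite pair_big /=.
have sz_take (w : (k + j).-tuple 'I_m) : size (take k w) == k.
  by rewrite size_takel // size_tuple leq_addr.
have sz_drop (w : (k + j).-tuple 'I_m) : size (drop k w) == j.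
  by rewrite size_drop size_tuple addKn.
rewrite (reindex (fun uv : k.-tuple 'I_m * j.-tuple 'I_m =>
   cat_tuple uv.1 uv.2)) /=; last first.
  exists (fun w => (Tuple (sz_take w), Tuple (sz_drop w))) => [[u v] _|w _].
    by congr pair; apply: val_inj; rewrite /= ?take_size_cat ?drop_size_cat ?size_tuple.
  by apply: val_inj; rewrite /= cat_take_drop.
by apply: eq_bigr => -[u v] _ /=; rewrite Pw_cat mulrA.
Qed.

(** Serves to turn a factor P(v) into an average over further rolls. *)
Lemma word_sum_eq_word (v : seq 'I_m) :
  word_sum (size v) (fun w => (w == v)%:R) = Pw p v.
Proof.
rewrite /word_sum (bigD1 (in_tuple v)) //= eqxx mulr1 big1 ?addr0 //.
move=> w neq; case: eqP => [eqw|]; last by rewrite mulr0.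
by case/eqP: neq; apply: val_inj.
Qed.

Lemma word_sum1 F : word_sum 1 F = \sum_(a < m) p a * F [:: a].
Proof.
rewrite /word_sum (reindex (fun a : 'I_m => [tuple a])) /=; last first.
  exists (fun t : 1.-tuple 'I_m => thead t) => [a _|t _] //=.
  by case/tupleP: t => a t; rewrite theadE [t]tuple0; apply: val_inj.
by apply: eq_bigr => a _; rewrite /Pw big_seq1.
Qed.

Lemma word_sumMr k F (c : R) :
  word_sum k (fun w => F w * c) = word_sum k F * c.
Proof. by rewrite /word_sum mulr_suml; apply: eq_bigr => w _; rewrite mulrA. Qed.

Lemma word_sumD k F G :
  word_sum k (fun w => F w + G w) = word_sum k F + word_sum k G.
Proof. by rewrite /word_sum -big_split; apply: eq_bigr => w _; rewrite mulrDr. Qed.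

Lemma word_sum_sum k (I : Type) (r : seq I) (Q : pred I) (F : I -> seq 'I_m -> R) :
  word_sum k (fun w => \sum_(i <- r | Q i) F i w) =
  \sum_(i <- r | Q i) word_sum k (F i).
Proof.
by rewrite /word_sum exchange_big; apply: eq_bigr => w _; rewrite mulr_sumr.
Qed.

End Words.

(** * First occurrences of [S] and the renewal relation *)

Section FirstOccurrence.
Variables (R : numFieldType) (m : nat) (p : 'I_m -> R) (S : seq 'I_m).

Definition prob_avoid (k : nat) : R :=
  word_sum p k (fun w => (~~ infix S w)%:R).

Lemma probYE k : probY p S k = word_sum p k (fun w => (first_occ S w)%:R).
Proof.
rewrite /probY big_mkcond; apply: eq_bigr => w _.
by case: first_occ; rewrite ?mulr1 ?mulr0.
Qed.

Lemma infix_rconsE (w : seq 'I_m) a :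
  infix S (rcons w a) = infix S w || suffix S (rcons w a).
Proof. by rewrite infix_rconsl orbC. Qed.

Lemma first_occ_rcons (w : seq 'I_m) a :
  first_occ S (rcons w a) = suffix S (rcons w a) && ~~ infix S w.
Proof. by rewrite /first_occ size_rcons /= -cats1 take_size_cat. Qed.

(** One letter after a word avoiding [S] either completes the first occurrence or leaves [S] absent;
    if [w] contains [S], all three indicators vanish. *)
Lemma avoid_first_occ (w : seq 'I_m) a :
  (~~ infix S w)%:R = (first_occ S (rcons w a))%:R +
                      (~~ infix S (rcons w a))%:R :> R.
Proof.
rewrite first_occ_rcons infix_rconsE.
by case: infix; case: suffix; rewrite /= ?addr0 ?add0r.
Qed.

Lemma prob_avoidS k : \sum_(i < m) p i = 1 ->
  prob_avoid k = probY p S k.+1 + prob_avoid k.+1.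
Proof.
move=> p1; rewrite probYE /prob_avoid -word_sumD -addn1 word_sum_cat.
(* The left side ignores the last roll, so it may be multiplied by the total probability 1 of that
   roll. *)
apply: eq_word_sum => w _; rewrite word_sum1 -[LHS]mul1r -[X in X * _]p1 mulr_suml.
by apply: eq_bigr => a _ /=; rewrite cats1 -avoid_first_occ.
Qed.

Lemma prob_avoid0 : S != [::] -> prob_avoid 0 = 1.
Proof. by move=> S0; rewrite /prob_avoid word_sum0 infixs0 (negPf S0). Qed.

Lemma probY_small k : (k < size S)%N -> probY p S k = 0.
Proof.
move=> ltk; rewrite /probY big_pred0 // => w; rewrite /first_occ.
case: suffixP => // -[u /(congr1 size)].
by rewrite size_cat size_tuple => eqk; have := leq_addl (size u) (size S);
  rewrite -eqk leqNgt ltk.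
Qed.

(** Telescopes [avoid_first_occ] along the letters of [v]. For [v = S] the last indicator is 0. *)
Lemma avoid_cat (u v : seq 'I_m) :
  (~~ infix S u)%:R =
  \sum_(1 <= j < (size v).+1) (first_occ S (u ++ take j v))%:R +
  (~~ infix S (u ++ v))%:R :> R.
Proof.
elim/last_ind: v => [|v a IH]; first by rewrite big_nil cats0 add0r.
have take_all : take (size v).+1 (rcons v a) = rcons v a.
  by rewrite take_oversize ?size_rcons.
rewrite IH size_rcons [in RHS]big_nat_recr //= take_all -rcons_cat -addrA -avoid_first_occ.
congr (_ + _); apply: eq_big_nat => j /andP[_ ltj].
by rewrite -cats1 takel_cat.
Qed.

(* If [S] first appears at time [k + j] in [u S], with [size u = k], then the
   prefix of [S] of length [j] is also a suffix of [S]. *)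
Lemma prob_avoid_overlap k : (forall a, a \in S -> 0 < p a) ->
  prob_avoid k =
  \sum_(Rw <- overlaps S) (Pw p Rw)^-1 * probY p S (k + size Rw).
Proof.
move=> p_gt0.
have -> : prob_avoid k = \sum_(1 <= j < (size S).+1)
    word_sum p k (fun u => (first_occ S (u ++ take j S))%:R).
  rewrite -word_sum_sum; apply: eq_word_sum => u _.
  by rewrite [LHS](avoid_cat u S) suffix_infix addr0.
rewrite /overlaps big_map big_filter [RHS]big_mkcond /= /index_iota subn1 /=.
rewrite !big_seq; apply: eq_bigr => j; rewrite mem_iota add1n ltnS => /andP[j0 jS].
have sz : size (take j S) = j by rewrite size_takel.
(* Both [S] and [v] end [u ++ v], and [v] is no longer than [S]; hence [v] ends [S]. *)
have suffix_take (u v : seq 'I_m) : size v = j -> suffix S (u ++ v) -> suffix v S.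
  move=> szv /suffixP[x eqx].
  have := congr1 (drop (size u)) eqx; rewrite (drop_size_cat v (erefl (size u))) => eqv.
  have szx := congr1 size eqx; rewrite !size_cat szv in szx.
  rewrite eqv drop_cat; case: ltnP => [ltu|_]; last exact: suffix_drop.
  by move: jS; rewrite -(leq_add2l (size u)) szx leq_add2r leqNgt ltu.
rewrite prefixE sz eqxx /=; case: ifP => [ovl|novl]; last first.
  rewrite /word_sum big1 // => u _; rewrite [first_occ _ _](_ : _ = false) ?mulr0 //.
  apply: contraFF novl => /andP[sufS _]; exact: suffix_take sufS.
have P0 : Pw p (take j S) != 0.
  apply: lt0r_neq0; rewrite /Pw big_seq; apply: prodr_gt0 => a ain.
  by apply: p_gt0; apply: mem_take ain.
(* P([take j S]) becomes an average over [j] further rolls [v]. A first occurrence at time [k + j]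
   makes [v] a suffix of [S] of length [j], as is [take j S], so no other [v] contributes. *)
apply: (mulfI P0); rewrite mulrA mulfV // mul1r probYE word_sum_cat.
rewrite mulrC -word_sumMr; apply: eq_word_sum => u _.
rewrite -(word_sum_eq_word p (take j S)) sz mulrC -word_sumMr.
apply: eq_word_sum => v szv; case: eqP => [->|neqv]; first by rewrite mul1r.
rewrite mul0r [first_occ _ _](_ : _ = false) //; apply/negP => /andP[sufS _].
case: neqv; have /suffixP[x eqx] := suffix_take u v szv sufS.
have /suffixP[y eqy] := ovl.
have szxy : size x = size y.
  by apply: (@addIn j); rewrite -{1}szv -sz -!size_cat -eqx -eqy.
have := congr1 (drop (size x)) eqx.
by rewrite (drop_size_cat v (erefl (size x))) {1}eqy szxy drop_size_cat.
Qed.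

Lemma probY_ge0 k : (forall i, 0 <= p i) -> 0 <= probY p S k.
Proof. by move=> p0; apply: sumr_ge0 => w _; apply: prodr_ge0. Qed.

Lemma prob_avoid_ge0 k : (forall i, 0 <= p i) -> 0 <= prob_avoid k.
Proof.
by move=> p0; apply: sumr_ge0 => w _; rewrite mulr_ge0 ?ler0n // prodr_ge0.
Qed.

End FirstOccurrence.

From mathcomp Require Import all_classical all_reals all_analysis.
Import Order.TTheory GRing.Theory Num.Theory.
Local Open Scope classical_set_scope.
Local Open Scope ring_scope.

(** * Elementary bounds for series and powers *)

Section SeriesBounds.
Import numFieldNormedType.Exports.

Lemma cvg_series_bounded (R : realType) (u : nat -> R) (C : R) :
  (forall k, 0 <= u k) -> (forall N, \sum_(0 <= k < N) u k <= C) ->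
  cvgn (series u).
Proof.
move=> u0 uC; apply: nondecreasing_is_cvgn.
  by apply: nondecreasing_series => k _ _; exact: u0.
by exists C => _ [N _ <-]; exact: uC.
Qed.

(** A discrete mean value bound; it lowers the exponent by one in the induction on moments. *)
Lemma expr_succ_le (R : realDomainType) (x : R) n : 0 <= x ->
  (x + 1) ^+ n.+1 - x ^+ n.+1 <= n.+1%:R * (x + 1) ^+ n.
Proof.
move=> x0; rewrite lerBlDr; elim: n => [|n IH].
  by rewrite expr0 mulr1 !expr1 addrC.
rewrite exprS mulrDl mul1r.
have step : x * (x + 1) ^+ n.+1 <= x ^+ n.+2 + n.+1%:R * (x + 1) ^+ n.+1.
  apply: (le_trans (ler_wpM2l x0 IH)); rewrite mulrDr -exprS addrC lerD2l.
  rewrite mulrCA ler_wpM2l // exprS ler_wpM2r ?exprn_ge0 ?addr_ge0 //.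
  by rewrite lerDl.
apply: (le_trans (lerD step (lexx _))).
by rewrite -[in leRHS](natr1 n.+1) mulrDl mul1r [leRHS]addrC addrA.
Qed.

End SeriesBounds.

(** * Moments of a sequence satisfying the renewal relation *)

Section Moments.
Import numFieldNormedType.Exports.
Variables (R : realType) (I : eqType) (r : seq I) (len : I -> nat) (c : I -> R).
Variables (l : nat) (q Q : nat -> R).
Hypothesis c_ge0 : forall i, 0 <= c i.
Hypothesis len_gt0 : forall i, i \in r -> (0 < len i)%N.
Hypothesis len_le : forall i, i \in r -> (len i <= l)%N.
Hypothesis l_gt0 : (0 < l)%N.
Hypothesis q_ge0 : forall k, 0 <= q k.
Hypothesis Q_ge0 : forall k, 0 <= Q k.
Hypothesis q_small : forall k, (k < l)%N -> q k = 0.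
Hypothesis Q_0 : Q 0%N = 1.
Hypothesis Q_rec : forall k, Q k = q k.+1 + Q k.+1.
Hypothesis Q_renewal : forall k, Q k = \sum_(i <- r) c i * q (k + len i)%N.

Definition psum n N : R := \sum_(0 <= k < N) k%:R ^+ n * q k.

(** Summation by parts with [q k.+1] = [Q k] - [Q k.+1]; the term of [psum] at 0 vanishes because
    [n] is positive. *)
Lemma psum_abel n N : (0 < n)%N ->
  \sum_(0 <= k < N) (k.+1%:R ^+ n - k%:R ^+ n) * Q k =
  psum n N.+1 + N%:R ^+ n * Q N.
Proof.
move=> n0; rewrite /psum; elim: N => [|N IH].
  by rewrite big_geq // big_nat1 expr0n (gtn_eqF n0) !mul0r addr0.
rewrite big_nat_recr //= IH [in RHS]big_nat_recr //= mulrBl addrACA subrr addr0.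
by rewrite Q_rec mulrDr addrA.
Qed.

Lemma psum0E N : psum 0 N.+1 = 1 - Q N.
Proof.
rewrite /psum; elim: N => [|N IH].
  by rewrite big_nat1 q_small // mulr0 Q_0 subrr.
by rewrite big_nat_recr //= IH Q_rec expr0 mul1r opprD addrA addrAC subrK.
Qed.

Lemma sum_shift_le (u : nat -> R) a N : (forall k, 0 <= u k) ->
  \sum_(0 <= k < N) u (k + a)%N <= \sum_(0 <= k < N + a) u k.
Proof.
move=> u0; rewrite [leRHS](big_cat_nat (n := a)) ?leq_addl //=.
rewrite -{3}[a]add0n big_addn addnK lerDr.
by apply: sumr_ge0.
Qed.

(** After expanding [Q k] by renewal, [len i >= 1] gives k + 1 <= k + [len i], so each inner sum is
    at most a shifted truncated moment. *)
Lemma tail_bounded n :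
  (exists C, forall N, psum n N <= C) ->
  exists C, forall N, \sum_(0 <= k < N) k.+1%:R ^+ n * Q k <= C.
Proof.
move=> [C hC]; exists (\sum_(i <- r) c i * C) => N.
under eq_bigr => k _ do rewrite Q_renewal mulr_sumr.
rewrite exchange_big /= 2!big_seq; apply: ler_sum => i ir.
under eq_bigr => k _ do rewrite mulrCA.
rewrite -mulr_sumr; apply: ler_wpM2l => //; apply: le_trans (hC (N + len i)%N).
apply: (le_trans _ (sum_shift_le (u := fun k => k%:R ^+ n * q k) (len i) N _)).
  apply: ler_sum => k _; rewrite ler_wpM2r // lerXn2r ?nnegrE ?ler0n //.
  by rewrite ler_nat -addn1 leq_add2l len_gt0.
by move=> k; rewrite mulr_ge0 // exprn_ge0.
Qed.

(** Induction on the exponent: [psum_abel] and [expr_succ_le] bound order n + 1 by the tail sum of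
    order n, which [tail_bounded] controls. *)
Lemma psum_bounded n : exists C, forall N, psum n N <= C.
Proof.
elim: n => [|n /tail_bounded [C hC]].
  exists 1 => -[|N]; first by rewrite /psum big_geq.
  by rewrite psum0E lerBlDr lerDl.
exists (n.+1%:R * C) => N; apply: (@le_trans _ _ (psum n.+1 N.+1)).
  by rewrite /psum [leRHS]big_nat_recr //= lerDl mulr_ge0 // exprn_ge0.
apply: (@le_trans _ _ (psum n.+1 N.+1 + N%:R ^+ n.+1 * Q N)).
  by rewrite lerDl mulr_ge0 // exprn_ge0.
rewrite -psum_abel //; apply: (le_trans _ (ler_wpM2l (ler0n _ _) (hC N))).
rewrite mulr_sumr; apply: ler_sum => k _; rewrite mulrA ler_wpM2r //.
by rewrite -natr1 expr_succ_le.
Qed.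

Definition moment n : R := limn (psum n).

Lemma psum_cvg n : psum n @ \oo --> moment n.
Proof.
have [C hC] := psum_bounded n.
suff : cvgn (psum n) by [].
apply: cvg_series_bounded hC => k.
by rewrite mulr_ge0 // exprn_ge0.
Qed.

(** The boundary term of [psum_abel] is squeezed below the general term of a convergent series. *)
Lemma tail_cvg0 n : (fun N => N%:R ^+ n * Q N) @ \oo --> (0 : R).
Proof.
have [C hC] := tail_bounded (psum_bounded n).
have u0 k : 0 <= k.+1%:R ^+ n * Q k by rewrite mulr_ge0 // exprn_ge0.
have := cvg_series_cvg_0 (cvg_series_bounded u0 hC).
apply: (@squeeze_cvgr _ _ _ _ (fun=> 0)); last exact: cvg_cst.
near=> N; rewrite mulr_ge0 ?exprn_ge0 //= ler_wpM2r //.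
by rewrite lerXn2r ?nnegrE ?ler0n // ler_nat.
Unshelve. all: by end_near.
Qed.

(** Almost sure finiteness of Y: the mass not yet counted is [Q N], which tends to 0. *)
Lemma moment0 : moment 0 = 1.
Proof.
have := @psum_cvg 0%N; rewrite -(cvg_shiftn 1) => h.
apply: (cvg_unique _ h) => //.
have -> : [sequence psum 0 (n + 1)%N]_n = (fun N => 1 - N%:R ^+ 0 * Q N).
  by apply/funext => N /=; rewrite addn1 psum0E mul1r.
suff : (fun N => 1 - N%:R ^+ 0 * Q N) @ \oo --> (1 - 0 : R) by rewrite subr0.
by apply: cvgB; [exact: cvg_cst | exact: (@tail_cvg0 0%N)].
Qed.

Definition renewal_coef j : R :=
  \sum_(i <- r) ((1 - (len i)%:R) ^+ j - (- (len i)%:R) ^+ j) * c i.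

(** With a = [len i] and k' = k + a, the weight is (k' + (1 - a))^n - (k' - a)^n; both powers are
    expanded in powers of k'. *)
Lemma psum_shift i n N : i \in r ->
  \sum_(0 <= k < N) (k.+1%:R ^+ n - k%:R ^+ n) * q (k + len i)%N =
  \sum_(j < n.+1) 'C(n, j)%:R *
     (((1 - (len i)%:R) ^+ j - (- (len i)%:R) ^+ j) * psum (n - j) (N + len i)).
Proof.
move=> ir; set a := len i.
transitivity (\sum_(0 <= k < N + a)
    ((k%:R + (1 - a%:R)) ^+ n - (k%:R + - a%:R) ^+ n) * q k).
  rewrite [RHS](big_cat_nat (n := a)) ?leq_addl //=.
  (* The extra terms k' < a vanish, since a <= [l] and [q] is zero below [l]. *)
  rewrite [X in _ = X + _]big_nat_cond [X in _ = X + _]big1 ?add0r; last first.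
    move=> k /andP[/andP[_ ka] _]; rewrite q_small ?mulr0 //.
    exact: leq_trans ka (len_le ir).
  rewrite -{2}[a]add0n big_addn addnK; apply: eq_bigr => k _.
  by rewrite natrD addrK -natr1 addrA addrAC addrK.
rewrite /psum; under [RHS]eq_bigr => j _ do rewrite mulr_sumr mulr_sumr.
rewrite exchange_big /=; apply: eq_bigr => k _.
rewrite !exprDn -sumrB mulr_suml; apply: eq_bigr => j _.
by rewrite -mulrnBl -mulrBr -[X in X * _ = _]mulr_natl -!mulrA; congr (_ * _); rewrite mulrCA.
Qed.

(* Moment form of [G = 1 + F G], where [G] and [F] are the exponential
   generating functions of the moments and of [renewal_coef]. *)
Lemma moment_rec n : (0 < n)%N ->
  moment n = \sum_(j < n.+1) 'C(n, j)%:R * (renewal_coef j * moment (n - j)).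
Proof.
move=> n0.
have lhs : (fun N => psum n N.+1 + N%:R ^+ n * Q N) @ \oo --> moment n.
  rewrite -(addr0 (moment n)); apply: cvgD; last exact: tail_cvg0.
  have := @psum_cvg n; rewrite -(cvg_shiftn 1).
  by under eq_fun do rewrite /= addn1.
apply: (cvg_unique _ lhs) => //.
(* By renewal the sequence is a finite combination of truncated moments, so limits pass termwise;
   moving the cutoff by [len i] leaves them unchanged. *)
have -> : (fun N => psum n N.+1 + N%:R ^+ n * Q N) = (fun N =>
    \sum_(i <- r) c i * \sum_(j < n.+1) 'C(n, j)%:R *
     (((1 - (len i)%:R) ^+ j - (- (len i)%:R) ^+ j) * psum (n - j) (N + len i))).
  apply/funext => N; rewrite -psum_abel //.
  under eq_bigr => k _ do rewrite Q_renewal mulr_sumr.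
  rewrite exchange_big /= 2!big_seq; apply: eq_bigr => i ir.
  by rewrite -psum_shift // mulr_sumr; apply: eq_bigr => k _; rewrite mulrCA.
rewrite (_ : \sum_(j < n.+1) _ = \sum_(i <- r) c i * \sum_(j < n.+1) 'C(n, j)%:R *
     (((1 - (len i)%:R) ^+ j - (- (len i)%:R) ^+ j) * moment (n - j))); last first.
  under [RHS]eq_bigr => i _ do rewrite mulr_sumr.
  rewrite exchange_big /=; apply: eq_bigr => j _.
  rewrite /renewal_coef mulr_suml mulr_sumr; apply: eq_bigr => i _.
  by rewrite [RHS]mulrCA [_ * c i]mulrC -!mulrA.
apply: cvg_big => [|i _]; first exact: add_continuous.
apply: cvgMl_tmp; apply: cvg_big => [|j _]; first exact: add_continuous.
do 2 apply: cvgMl_tmp.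
have := @psum_cvg (n - j); by rewrite -(cvg_shiftn (len i)).
Qed.

End Moments.

(* E(Y^n) = \sum_k k^n P(Y = k), as a convergent series with the given sum. *)
Theorem theorem4p8 (R : realType) (m : nat) (p : 'I_m -> R) (S : seq 'I_m) (n : nat) :
  (0 < m)%N ->
  (forall i, 0 <= p i) ->
  \sum_(i < m) p i = 1 ->
  S != [::] ->
  (forall a, a \in S -> 0 < p a) ->
  (1 <= n)%N ->
  series (fun k : nat => (k%:R : R) ^+ n * probY p S k) @ \oo -->
    \sum_(P in set_partitions n)
       (factorial #|P|)%:R *
       \prod_(B in P)
          \sum_(Rw <- overlaps S)
             (((1 - (size Rw)%:R) ^+ #|B| - (- (size Rw)%:R) ^+ #|B|) / Pw p Rw).
Proof.
move=> _ p_ge0 p_sum1 S_neq0 p_gt0 _.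
pose c Rw := (Pw p Rw)^-1.
have c_ge0 Rw : 0 <= c Rw by rewrite invr_ge0 prodr_ge0.
have len_bounds Rw : Rw \in overlaps S -> (0 < size Rw <= size S)%N.
  case/mapP=> k; rewrite mem_filter mem_iota add1n ltnS => /and3P[_ k0 kS] ->.
  by rewrite size_takel // k0.
have len_gt0 Rw : Rw \in overlaps S -> (0 < size Rw)%N by case/len_bounds/andP.
have len_le Rw : Rw \in overlaps S -> (size Rw <= size S)%N by case/len_bounds/andP.
have S_gt0 : (0 < size S)%N by rewrite lt0n size_eq0.
have q_ge0 k : 0 <= probY p S k by exact: probY_ge0.
have Q_ge0 k : 0 <= prob_avoid p S k by exact: prob_avoid_ge0.
have q_small k : (k < size S)%N -> probY p S k = 0 by exact: probY_small.
have Q_0 : prob_avoid p S 0 = 1 by exact: prob_avoid0.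
have Q_rec k : prob_avoid p S k = probY p S k.+1 + prob_avoid p S k.+1.
  exact: prob_avoidS.
have Q_renewal k : prob_avoid p S k =
    \sum_(Rw <- overlaps S) c Rw * probY p S (k + size Rw).
  exact: prob_avoid_overlap.
pose f := renewal_coef (overlaps S) size c.
suff -> : \sum_(P in set_partitions n) (factorial #|P|)%:R * \prod_(B in P) f #|B| =
    moment (probY p S) n.
  exact: (psum_cvg c_ge0 len_gt0 S_gt0 q_ge0 Q_ge0 q_small Q_0 Q_rec Q_renewal).
(* Writing [n] as the size of the full set over ['I_n] lets [partition_sumE] apply with the moments
   as [M]. *)
rewrite -[in RHS](card_ord n) -cardsT -(@partition_sumE _ _ f) //.
- by apply: eq_bigl => P; rewrite inE.
- exact: (moment0 c_ge0 len_gt0 S_gt0 q_ge0 Q_ge0 q_small Q_0 Q_rec Q_renewal).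
- by rewrite /f /renewal_coef big1 // => Rw _; rewrite subrr mul0r.
- exact: (moment_rec c_ge0 len_gt0 len_le S_gt0 q_ge0 Q_ge0 q_small Q_0 Q_rec Q_renewal).
Qed.
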